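(* Let $(X,d)$ be a compact metric space, $f:X\to X$ a continuous map, and $\mathcal{U}$ a finite open cover of $X$. Then $$\dim_H(X)\cdot h_L^+(f,\mathcal{U})\ \ge\ h_{\mathcal{U}}(f).$$
   Context: Lebesgue number: for an open cover $\mathcal{U}$ of $X$, the Lebesgue number $\delta(\mathcal{U})$ is the largest number $\delta>0$ such that every open ball of radius at most $\delta$ is contained in some element of $\mathcal{U}$. If $X\notin\mathcal{U}$, it equals $\min_{x\in X}\delta(\mathcal{U},x)$, where $\delta(\mathcal{U},x)=\sup_{U\in\mathcal{U}}\inf_{y\in X\setminus U}d(x,y)$. Lebesgue numbers are always bounded by the diameter of the space. For open covers, $\mathcal{U}\vee\mathcal{V}=\{U\cap V: U\in\mathcal{U},V\in\mathcal{V}\}$, $f^{-k}(\mathcal{U})=\{f^{-k}(U):U\in\mathcal{U}\}$, $\mathcal{U}_f^n=\bigvee_{k=0}^{n-1}f^{-k}(\mathcal{U})$, $\delta_n(f,\mathcal{U})=\delta(\mathcal{U}_f^n)$, and $h_L^+(f,\mathcal{U})=\limsup_{n\to\infty}-\frac1n\log\delta_n(f,\mathcal{U})$. The quantity $h_{\mathcal{U}}(f)$ from Bowen's definition of topological entropy: for $B\subset X$ write $B\succ\mathcal{U}$ if $B$ is contained in some element of $\mathcal{U}$. Let $n_{f,\mathcal{U}}(B)$ be the largest nonnegative integer $n$ such that $f^k(B)\succ\mathcal{U}$ for $k=0,1,\dots,n-1$; it is $0$ if $B\not\succ\mathcal{U}$, and $n_{f,\mathcal{U}}(B)=\infty$ if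 $f^k(B)\succ\mathcal{U}$ for all $k$. Put $\mathrm{diam}_{\mathcal{U}}(B)=\exp(-n_{f,\mathcal{U}}(B))$. For a cover $\mathcal{B}$ of $X$ put $\mathrm{diam}_{\mathcal{U}}(\mathcal{B})=\sup_{B\in\mathcal{B}}\mathrm{diam}_{\mathcal{U}}(B)$ and, for real $\lambda$, $D_{\mathcal{U}}(\mathcal{B},\lambda)=\sum_{B\in\mathcal{B}}(\mathrm{diam}_{\mathcal{U}}(B))^\lambda$. Let $\mu_{\mathcal{U},\lambda}(X)=\lim_{\epsilon\to0}\inf\{D_{\mathcal{U}}(\mathcal{B},\lambda):\mathcal{B}\text{ is a cover of }X\text{ and }\mathrm{diam}_{\mathcal{U}}(\mathcal{B})<\epsilon\}$. Then $h_{\mathcal{U}}(f)$ is the number such that $\mu_{\mathcal{U},\lambda}(X)=\infty$ for $\lambda<h_{\mathcal{U}}(f)$ and $\mu_{\mathcal{U},\lambda}(X)=0$ for $\lambda>h_{\mathcal{U}}(f)$. $\dim_H(X)$ is the Hausdorff dimension of $X$, defined through the classical Hausdorff measures $\mu_\lambda(X)=\lim_{\epsilon\to0}\inf\{\sum_{V\in\mathcal{V}}(\mathrm{diam}(V))^\lambda:\mathcal{V}\text{ is a cover of }X\text{ and }\sup_{V\in\mathcal{V}}\mathrm{diam}(V)<\epsilon\}$: it is the number such that $\mu_\lambda(X)=\infty$ for $\lambda<\dim_H(X)$ and $\mu_\lambda(X)=0$ for $\lambda>\dim_H(X)$.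
   Formalization: The inequality is asserted only when the product of dim_H(X) and h_L^+(f,U) is not of the indeterminate form 0·∞, where it is undefined (and, with 0·∞ = 0, the claim fails for the full 2-shift with d = 1/(first differing index)). *)

(* Defs.v *)
From HB Require Import structures.
From mathcomp Require Import all_boot all_order all_algebra.
From mathcomp Require Import all_classical all_reals all_analysis.

Set Implicit Arguments.
Unset Strict Implicit.
Unset Printing Implicit Defensive.

Import Order.TTheory GRing.Theory Num.Theory.
Import numFieldNormedType.Exports.

Local Open Scope classical_set_scope.
Local Open Scope ring_scope.

Section covers.
Context {T : Type}.
Implicit Types (U V : set (set T)) (f : T -> T).

Definition is_cover U := \bigcup_(A in U) A = [set: T].

Definition cover_join U V : set (set T) := [set A `&` B | A in U & B in V].

Definition cover_preimage f U : set (set T) := [set f @^-1` A | A in U].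

(* U_f^n, the join of the f^{-k}(U) for k < n; the trivial cover {T} is neutral
   for cover_join. *)
Definition iterated_cover f U (n : nat) : set (set T) :=
  \big[cover_join/[set setT]]_(k < n) cover_preimage (iter k f) U.

(* B \succ U *)
Definition subordinate (B : set T) U := exists2 A, U A & B `<=` A.

End covers.

Definition open_cover {T : topologicalType} (U : set (set T)) :=
  (forall A, U A -> open A) /\ is_cover U.

Section diameter.
Context {R : realType} {X : metricType R}.

(* The maximum with 0 only serves to give the empty set diameter 0. *)
Definition diam (A : set X) : \bar R :=
  maxe 0%E (ereal_sup [set (mdist x y)%:E | x in A & y in A]).

(* The bound by the diameter of the space is automatic unless X is itself a
   member of U; in that case it makes the Lebesgue number equal to diam X
   instead of infinite.  On a one-point space the set below is empty and the
   value is 0. *)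
Definition lebesgue_number (U : set (set X)) : R :=
  sup [set r : R | [/\ 0 < r, (r%:E <= diam [set: X])%E &
    forall (x : X) (s : R), 0 < s <= r -> subordinate (ball x s) U]].

(* h_L^+(f, U).  The real logarithm has ln 0 = 0; for continuous f and an open cover of a compact
   space this value is only used on a space with at most one point. *)
Definition lebesgue_entropy (f : X -> X) (U : set (set X)) : \bar R :=
  limn_esup (fun n : nat =>
    (- (n%:R^-1 * ln (lebesgue_number (iterated_cover f U n))))%:E).

End diameter.

Section dimension.
Context {R : realType}.

(* x ^ l for x >= 0, with 0 ^ l = +oo for l < 0, whereas poweR 0 l = 0. *)
Definition epow (x : \bar R) (l : R) : \bar R :=
  if (x == 0%E) && (l < 0) then +oo%E else poweR x l.

Section outer_size.
Context {T : Type}.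
Variable w : set T -> \bar R.

Definition cover_size (B : set (set T)) : \bar R := ereal_sup [set w b | b in B].

Definition cover_sum (B : set (set T)) (l : R) : \bar R :=
  (\esum_(b in B) epow (w b) l)%E.

(* As usual for Hausdorff measures, covers are countable: uncountable families
   would allow the cover by all singletons, which has sum 0 for every l > 0. *)
Definition fine_covers (e : R) : set (set (set T)) :=
  [set B | [/\ countable B, is_cover B & (cover_size B < e%:E)%E]].

Definition premeasure (l e : R) : \bar R :=
  ereal_inf [set cover_sum B l | B in fine_covers e].

(* The Hausdorff-type l-measure of the whole space, w playing the role of the
   diameter. *)
Definition hausdorff_type_measure (l : R) : \bar R :=
  lim (premeasure l e @[e --> 0^'+]).

End outer_size.

Definition is_critical_exponent (mu : R -> \bar R) (h : \bar R) :=
  (forall l : R, (l%:E < h)%E -> mu l = +oo%E) /\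
  (forall l : R, (h < l%:E)%E -> mu l = 0%E).

Definition critical_exponent (mu : R -> \bar R) : \bar R :=
  xget 0%E (is_critical_exponent mu).

End dimension.

Definition hausdorff_measure {R : realType} (X : metricType R) : R -> \bar R :=
  hausdorff_type_measure (@diam R X).

Definition hausdorff_dimension {R : realType} (X : metricType R) : \bar R :=
  critical_exponent (hausdorff_measure X).

Section bowen.
Context {R : realType} {T : Type}.
Variables (f : T -> T) (U : set (set T)).

(* n_{f,U}(B), as an extended real *)
Definition bowen_time (B : set T) : \bar R :=
  ereal_sup [set n%:R%:E | n in
    [set n : nat | forall k : nat, (k < n)%N -> subordinate (iter k f @` B) U]].

Definition bowen_diam (B : set T) : \bar R := expeR (- bowen_time B)%E.

Definition bowen_measure : R -> \bar R := hausdorff_type_measure bowen_diam.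

(* h_U(f) *)
Definition bowen_entropy : \bar R := critical_exponent bowen_measure.

End bowen.

(* The critical exponents above are well defined. *)

Lemma is_critical_exponent_uniq {R : realType} (mu : R -> \bar R) (h h' : \bar R) :
  is_critical_exponent mu h -> is_critical_exponent mu h' -> h = h'.
Proof.
suff H a b : is_critical_exponent mu a -> is_critical_exponent mu b -> (a <= b)%E.
  by move=> ha hb; apply/eqP; rewrite eq_le !H.
move=> [al _] [_ bg]; rewrite leNgt; apply/negP => ba.
have [l /andP[bl la]] : exists l : R, (b < l%:E < a)%E.
  case: a b ba {al bg} => [a| |] [b| |] //=.
  - by rewrite lte_fin => ba; exists ((b + a) / 2); rewrite !lte_fin !midf_lt.
  - by move=> _; exists (a - 1); rewrite ltNyr lte_fin ltrBlDr ltrDl ltr01.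
  - by move=> _; exists (b + 1); rewrite ltry lte_fin ltrDl ltr01.
  - by move=> _; exists 0; rewrite ltNyr ltry.
by have := bg _ bl; rewrite (al _ la).
Qed.

Lemma critical_exponentP {R : realType} {T : Type} (w : set T -> \bar R) :
  (forall A, (0 <= w A)%E) ->
  is_critical_exponent (hausdorff_type_measure w)
    (critical_exponent (hausdorff_type_measure w)).
Proof.
move=> w0; set mu := hausdorff_type_measure w.
have epow0 x l : (0 <= epow x l :> \bar R)%E.
  by rewrite /epow; case: ifP => // _; exact: poweR_ge0.
have sum0 B l : (0 <= cover_sum w B l)%E by apply: esum_ge0.
have pre0 l e : (0 <= premeasure w l e)%E.
  by apply: le_ereal_inf_tmp => _ [B _ <-].
have preN l (e e' : R) : e <= e' -> (premeasure w l e' <= premeasure w l e)%E.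
  move=> ee'; apply: ereal_inf_le_tmp => _ [B [cB iB sB] <-]; exists B => //.
  by split=> //; apply: (lt_le_trans sB); rewrite lee_fin.
have muE l : mu l = ereal_sup (premeasure w l @` [set e | 0 < e]).
  rewrite /mu /hausdorff_type_measure; apply/cvg_lim => //.
  have := @nonincreasing_at_right_cvge R (premeasure w l) 0 (BInfty R false) isT.
  rewrite (_ : [set` _] = [set e | 0 < e]); last first.
    by apply/seteqP; split => x /=; rewrite in_itv /= andbT.
  by apply=> x y _ _; exact: preN.
have preM (l l' e : R) : 0 < e -> l < l' ->
    (premeasure w l' e <= (e `^ (l' - l))%:E * premeasure w l e)%E.
  move=> e0 ll'; have c0 : 0 < e `^ (l' - l) by rewrite powR_gt0.
  rewrite -lee_pdivrMl//; apply: le_ereal_inf_tmp => _ [B [cB iB sB] <-].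
  rewrite lee_pdivrMl//; apply: (@le_trans _ _ (cover_sum w B l')).
    by apply: ereal_inf_lbound; exists B.
  have wB b : B b -> (epow (w b) l' <= (e `^ (l' - l))%:E * epow (w b) l)%E.
    move=> Bb; have wbe : (w b < e%:E)%E.
      by apply: le_lt_trans sB; apply: ereal_sup_ubound; exists b.
    move: (w0 b) wbe; case: (w b) => [r| |]; rewrite ?leNye_eq //.
    rewrite lee_fin lte_fin => r0 re; rewrite /epow eqe.
    have [rE|rN] := eqVneq r 0 => /=.
      subst r; case: (ltP l 0) => l0; first by rewrite gt0_muley ?lte_fin// leey.
      have l'0 := le_lt_trans l0 ll'.
      rewrite ltNge (ltW l'0) /= powR0 ?gt_eqF// -EFinM lee_fin.
      by rewrite mulr_ge0// powR_ge0.
    have rp : 0 < r by rewrite lt_neqAle eq_sym rN.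
    have -> : r `^ l' = r `^ (l' - l) * r `^ l.
      by rewrite -powRD ?subrK//; apply/implyP => _; exact: lt0r_neq0.
    rewrite -EFinM lee_fin ler_pM2r ?powR_gt0//.
    by apply: ge0_ler_powR; rewrite ?nnegrE ?subr_ge0; exact: ltW.
  apply: ge_ereal_sup => _ [F [finF FB] <-].
  apply: (@le_trans _ _ (\sum_(b \in F) ((e `^ (l' - l))%:E * epow (w b) l))%E).
    by apply: lee_fsum => // b Fb; apply/wB/FB.
  rewrite -ge0_mule_fsumr//; apply: lee_wpmul2l; first exact: ltW.
  by apply: ereal_sup_ubound; exists F.
have mu0 l l' : l < l' -> mu l != +oo%E -> mu l' = 0%E.
  move=> ll' ml; have mf : mu l \is a fin_num.
    rewrite fin_numE ml andbT; apply/eqP => mE.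
    have : (premeasure w l 1 <= mu l)%E.
      by rewrite muE; apply: ereal_sup_ubound; exists 1 => //=.
    by rewrite mE leNgt (lt_le_trans _ (pre0 _ _)).
  set M := fine (mu l); have M0 : 0 <= M.
    rewrite -lee_fin fineK//; apply: le_trans (pre0 l 1) _.
    by rewrite muE; apply: ereal_sup_ubound; exists 1 => //=.
  have pM e : 0 < e -> (premeasure w l' e <= (e `^ (l' - l) * M)%:E)%E.
    move=> e0; apply: (le_trans (preM _ _ _ e0 ll')).
    rewrite EFinM; apply: lee_wpmul2l; last first.
      by rewrite fineK// muE; apply: ereal_sup_ubound; exists e.
    by rewrite lee_fin powR_ge0.
  apply/eqP; rewrite eq_le; apply/andP; split; last first.
    apply: le_trans (pre0 l' 1) _.
    by rewrite muE; apply: ereal_sup_ubound; exists 1 => //=.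
  rewrite muE; apply: ge_ereal_sup => _ [e /= e0 <-].
  apply/lee_addgt0Pr => d d0; rewrite add0e.
  pose t := (d / (M + 1)) `^ (l' - l)^-1.
  have M1 : 0 < M + 1 by rewrite ltr_wpDl.
  have t0 : 0 < t by rewrite powR_gt0 ?divr_gt0.
  have m0 : 0 < Num.min e t by rewrite lt_min e0 t0.
  apply: (@le_trans _ _ (premeasure w l' (Num.min e t))).
    by apply: preN; rewrite ge_min lexx.
  apply: (le_trans (pM _ m0)); rewrite lee_fin.
  apply: (@le_trans _ _ (t `^ (l' - l) * M)).
    apply: ler_wpM2r => //; apply: ge0_ler_powR; rewrite ?nnegrE ?subr_ge0 ?(ltW ll')//;
      [exact: ltW|exact: ltW|by rewrite ge_min lexx orbT].
  have -> : t `^ (l' - l) = d / (M + 1).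
    rewrite /t -powRrM mulVf ?powRr1 ?divr_ge0 ?ltW//.
    by rewrite subr_eq0 gt_eqF.
  rewrite mulrAC ler_pdivrMr// ler_pM2l//.
  by rewrite ltW// ltrDl.
apply: (@xgetPex _ 0%E (is_critical_exponent mu)).
exists (ereal_inf [set l%:E | l in [set l | mu l = 0%E]]); split=> l.
  move=> lh; apply/eqP; apply: contraT => ml.
  suff : (ereal_inf [set l0%:E | l0 in [set l1 | mu l1 = 0%E]] <= l%:E)%E.
    by rewrite leNgt lh.
  apply/lee_addgt0Pr => d d0; apply: ereal_inf_lbound; exists (l + d) => //=.
  by apply: mu0 ml; rewrite ltrDl.
move=> /ereal_inf_lt [_ [l1 /= m1 <-]]; rewrite lte_fin => l1l.
by apply: (mu0 _ _ l1l); rewrite m1.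
Qed.

Lemma diam_ge0 {R : realType} {X : metricType R} (A : set X) : (0 <= diam A)%E.
Proof. by rewrite /diam le_max lexx. Qed.

Lemma hausdorff_dimensionP {R : realType} (X : metricType R) :
  is_critical_exponent (hausdorff_measure X) (hausdorff_dimension X).
Proof. by apply: critical_exponentP => A; exact: diam_ge0. Qed.

Lemma bowen_entropyP {R : realType} {T : Type} (f : T -> T) (U : set (set T)) :
  is_critical_exponent (@bowen_measure R T f U) (bowen_entropy f U).
Proof. by apply: critical_exponentP => A; exact: expeR_ge0. Qed.

(* Main.v *)
(* For l > dim_H X and h > h_L^+(f, U), the Lebesgue number of U_f^n exceeds
   exp(- n h) for large n, so that a set V with diam V <= exp(- n h) lies in an
   element of U_f^n and diam_U V <= exp(- n).  Choosing n maximal for V gives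
   (diam_U V)^(l h) <= exp(l h) (diam V)^l.  Summing over fine covers, the
   Bowen measure of exponent l h vanishes because the Hausdorff measure of
   exponent l does, hence h_U(f) <= l h; let l and h decrease to their limits. *)
Require Import Defs.
From HB Require Import structures.
From mathcomp Require Import all_boot all_order all_algebra.
From mathcomp Require Import all_classical all_reals all_analysis.
From mathcomp Require Import lra.

Import Order.TTheory GRing.Theory Num.Theory.

Local Open Scope classical_set_scope.
Local Open Scope ereal_scope.

Lemma limn_esup_lt {R : realType} {u : (\bar R)^nat} {h : \bar R} :
  limn_esup u < h -> \forall n \near \oo, u n < h.
Proof.
rewrite limn_esup_lim (cvg_lim _ (@cvg_esups_inf _ u))//.
move=> /ereal_inf_lt[_ [N _ <-] Nh]; exists N => // n Nn.
by apply: le_lt_trans Nh; apply: ereal_sup_ubound; exists n.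
Qed.

(** * Subordination to joins and iterated covers *)

Section covers.
Context {T : Type}.
Implicit Types (U : set (set T)) (f : T -> T).

Lemma subordinate_big_cover_join (G : nat -> set (set T)) (n : nat) (B : set T) :
  subordinate B (\big[cover_join/[set setT]]_(k < n) G k) ->
  forall k, (k < n)%N -> subordinate B (G k).
Proof.
(* [G] stays general because splitting off index 0 leaves the join of the shifted family
   [G i.+1]. *)
elim: n G => [|n IH] G //; rewrite big_ord_recl => -[_ [A GA [C GC <-]] BAC].
case=> [_|k kn]; first by exists A => // x /BAC[].
by apply: (IH (fun i => G i.+1)) => //; exists C => // x /BAC[].
Qed.

Lemma subordinate_iterated_cover f U (n : nat) (B : set T) :
  subordinate B (iterated_cover f U n) ->
  forall k, (k < n)%N -> subordinate (iter k f @` B) U.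
Proof.
move=> BU k kn.
have [_ [A UA <-] BA] := @subordinate_big_cover_join
  (fun i => cover_preimage (iter i f) U) n B BU k kn.
by exists A => // _ [x /BA Ax <-].
Qed.

Lemma subordinate_set1 {U} (x : T) : is_cover U -> subordinate [set x] U.
Proof.
move=> cU; have [A UA Ax] : (\bigcup_(A in U) A) x by rewrite cU.
by exists A => // _ ->.
Qed.

Lemma subordinateS {A B : set T} {U} :
  A `<=` B -> subordinate B U -> subordinate A U.
Proof. by move=> AB [C UC BC]; exists C => // x /AB/BC. Qed.

End covers.

Lemma open_cover_iterated {T : topologicalType} {f : T -> T} {U : set (set T)}
    (n : nat) :
  continuous f -> open_cover U -> open_cover (iterated_cover f U n).
Proof.
move=> cf [oU cU]; rewrite /iterated_cover; apply: big_ind.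
- split=> [_ ->|]; first exact: openT.
  by apply/seteqP; split=> // x _; exists setT.
- move=> A B [oA cA] [oB cB]; split=> [_ [a Aa [b Bb <-]]|].
    by apply: openI; [exact: oA|exact: oB].
  apply/seteqP; split=> // x _.
  have [a Aa ax] : (\bigcup_(a in A) a) x by rewrite cA.
  have [b Bb bx] : (\bigcup_(b in B) b) x by rewrite cB.
  by exists (a `&` b) => //; exists a => //; exists b.
- move=> k _; split=> [_ [A UA <-]|].
    apply: open_comp; last exact: oU.
    move=> x _; elim: (k : nat) x => [|j IH] x /=; first exact: cvg_id.
    by apply: (@continuous_comp _ _ _ (iter j f) f); [exact: IH|exact: cf].
  apply/seteqP; split=> // x _.
  have [A UA Ax] : (\bigcup_(A in U) A) (iter k f x) by rewrite cU.
  by exists (iter k f @^-1` A) => //; exists A.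
Qed.

(** * Lebesgue numbers on a compact metric space *)

Section metric.
Context {R : realType} {X : metricType R}.
Implicit Types (U : set (set X)) (V : set X).

Lemma compact_mdist_bounded :
  compact [set: X] -> exists M : R, forall x y : X, (mdist x y <= M)%R.
Proof.
move=> cX; have [[x0 _]|X0] := pselect ([set: X] !=set0); last first.
  by exists 0%R => x; exfalso; apply: X0; exists x.
(* Near-covering form of compactness: what holds locally for all large r holds at all points at once
   for large r. On the unit ball about x, r > d(x0, x) + 1 suffices. *)
have [x _|M [_ HM]] := (compact_near_coveringP _).1 cX R (+oo%R)
  (fun r x => mdist x0 x < r)%R _.
  exists (ball x 1%R, [set r | (mdist x0 x + 1 < r)%R]).
    by split=> /=; [exact: near_ball|apply: nbhs_pinfty_gt; exact: num_real].
  move=> [y r] /= []; rewrite ballEmdist /= => xy; apply: le_lt_trans.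
  by apply: le_trans (metric_triangle x0 x y) _; rewrite lerD2l ltW.
exists ((M + 1) + (M + 1))%R => x y.
have M1 : (M < M + 1)%R by rewrite ltrDl.
apply: le_trans (metric_triangle x x0 y) _; rewrite metric_sym.
by apply: lerD; apply/ltW/HM.
Qed.

(** Lebesgue's covering lemma. If the ball of radius e about x lies in a member of [U], so do all
    balls of radius r < e/2 centred within e/2 of x; compactness makes r uniform. *)
Lemma compact_ball_subordinate {U} : compact [set: X] -> open_cover U ->
  \forall r \near 0^'+, forall x : X, subordinate (ball x r) U.
Proof.
move=> cX [oU cU].
have [x _|e e0 He] := (compact_near_coveringP _).1 cX R (0^'+)%R
  (fun r x => subordinate (ball x r) U) _; last first.
  by exists e => // r re r0 x; exact: He.
have [A UA Ax] : (\bigcup_(A in U) A) x by rewrite cU.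
have /nbhs_ballP[e /= e0 eA] := open_nbhs_nbhs (conj (oU _ UA) Ax).
have e20 : (0 < e / 2)%R by rewrite divr_gt0.
exists (ball x (e / 2)%R, [set r | (r < e / 2)%R]).
  by split=> /=; [exact: near_ball|exact: nbhs_right_lt].
move=> [y r] /= [xy re]; exists A => // z yz; apply: eA.
by rewrite (splitr e); apply: (ball_triangle xy); apply: le_ball yz; exact: ltW.
Qed.

Lemma mdist_le_diam {V x y} : V x -> V y -> (mdist x y)%:E <= diam V.
Proof.
move=> Vx Vy; rewrite /diam le_max; apply/orP; right.
by apply: ereal_sup_ubound; exists x => //; exists y.
Qed.

Lemma lebesgue_number_le U (M : R) : (0 <= M)%R ->
  (forall x y : X, mdist x y <= M)%R -> (lebesgue_number U <= M)%R.
Proof.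
move=> M0 dM; rewrite /lebesgue_number; set S := [set r | _].
have [S0|/set0P S0] := eqVneq S set0; first by rewrite S0 sup0.
apply: ge_sup => // r [_ rd _]; rewrite -lee_fin; apply: le_trans rd _.
rewrite /diam ge_max lee_fin M0 /=; apply: ge_ereal_sup => _ [x _ [y _ <-]].
by rewrite lee_fin.
Qed.

(** An admissible radius must not exceed the diameter, so the small radius from the covering lemma
    is also taken below the distance of two distinct points. *)
Lemma lebesgue_number_gt0 {U} : compact [set: X] -> open_cover U ->
  0 < diam [set: X] -> (0 < lebesgue_number U)%R.
Proof.
move=> cX oU d0; have [M dM] := compact_mdist_bounded cX.
have [x0 [y xy]] : exists x y : X, (0 < mdist x y)%R.
  by move: d0; rewrite /diam lt_max ltxx /= => /ereal_sup_gt[_ [x _ [y _ <-]]];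
    rewrite lte_fin => ?; exists x, y.
have [r [r0 rd rU]] : exists r : R, [/\ (0 < r)%R, (r < mdist x0 y)%R &
    forall x : X, subordinate (ball x r) U].
  have : \forall r \near (0%R : R)^'+, [/\ (0 < r)%R, (r < mdist x0 y)%R &
      forall x : X, subordinate (ball x r) U].
    near=> r; split; near: r.
    - exact: nbhs_right_gt.
    - exact: nbhs_right_lt.
    - exact: compact_ball_subordinate.
  by move=> /filter_ex.
apply: (lt_le_trans r0); apply: ub_le_sup.
  exists M => s [_ sd _]; rewrite -lee_fin; apply: le_trans sd _.
  rewrite /diam ge_max lee_fin (le_trans _ (dM x0 x0)) ?mdist_ge0//=.
  by apply: ge_ereal_sup => _ [x _ [z _ <-]]; rewrite lee_fin.
split=> //.
  by rewrite (le_trans _ (@mdist_le_diam setT x0 y I I))// lee_fin ltW.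
move=> x s /andP[_ sr]; apply: subordinateS (rU x); exact: le_ball.
Unshelve. all: by end_near. Qed.

(** The strict inequality leaves room for an admissible radius s > diam V, and the open ball of
    radius s about any point of V contains V. *)
Lemma subordinate_lebesgue_number {U V} : V !=set0 ->
  diam V < (lebesgue_number U)%:E -> subordinate V U.
Proof.
move=> [x Vx]; case dV : (diam V) => [d| |] //; last first.
  by have := diam_ge0 V; rewrite dV.
rewrite lte_fin /lebesgue_number; set S := [set r | _] => dS.
have d0 : (0 <= d)%R by rewrite -lee_fin -dV diam_ge0.
have [S0|/set0P S0] := eqVneq S set0.
  by move: dS; rewrite S0 sup0 ltNge d0.
have [s [s0 _ sU] ds] := sup_gt S0 dS.
apply: subordinateS (sU x s _); last by rewrite s0 lexx.
move=> y Vy; rewrite ballEmdist /=; apply: le_lt_trans ds.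
by rewrite -lee_fin -dV mdist_le_diam.
Qed.

(** A bound on distances bounds all the Lebesgue numbers uniformly in n, whereas a negative limsup
    would force them to grow exponentially. *)
Lemma lebesgue_entropy_ge0 (f : X -> X) U :
  compact [set: X] -> 0 <= lebesgue_entropy f U.
Proof.
move=> cX; rewrite leNgt; apply/negP => H0.
have [c c0 Hc] : exists2 c : R, (0 < c)%R & lebesgue_entropy f U < (- c)%:E.
  move: H0; case: lebesgue_entropy => [r| |] //.
    rewrite lte_fin => r0; exists (- r / 2)%R; first by rewrite divr_gt0// oppr_gt0.
    by rewrite lte_fin; lra.
  by move=> _; exists 1%R => //; rewrite ltNyr.
have [M dM] := compact_mdist_bounded cX.
have [N _ HN] := limn_esup_lt Hc.
(* Since 1 <= M', [ln M'] is nonnegative, which covers the case d <= 0, where [ln d] is 0. *)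
pose M' := Num.max 1%R M.
have M'1 : (1 <= M')%R by rewrite le_max lexx.
(* Both n >= N and c n > ln M' hold. *)
pose n := (N + (Num.truncn (ln M' / c)).+1)%N.
have := HN n (leq_addr _ _); rewrite lte_fin ltrN2.
have n0 : (0 < n%:R :> R)%R by rewrite ltr0n /n addnS.
rewrite ltNge => /negP; apply; rewrite mulrC ler_pdivrMr//.
set d := lebesgue_number _.
have dM' : (d <= M')%R.
  by apply: lebesgue_number_le => [|x y]; [lra|rewrite le_max dM orbT].
apply: (@le_trans _ _ (ln M')).
  have [d0|d0] := leP d 0%R; first by rewrite ln0// ln_ge0.
  by rewrite ler_ln ?posrE// (lt_le_trans d0).
rewrite mulrC -ler_pdivrMr//; apply: (@le_trans _ _ (Num.truncn (ln M' / c)).+1%:R%R).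
  by apply/ltW/truncnS_gt.
by rewrite ler_nat leq_addl.
Qed.

Lemma lebesgue_entropy_subordinate {f : X -> X} {U} {h : R} (x0 : X) :
  compact [set: X] -> continuous f -> open_cover U ->
  lebesgue_entropy f U < h%:E ->
  \forall n \near \oo, forall V,
    diam V <= (expR (- (n%:R * h)))%:E -> subordinate V (iterated_cover f U n).
Proof.
(* Starting at N + 1 keeps n positive, as the division by n requires. *)
move=> cX cf oU /limn_esup_lt[N _ HN]; exists N.+1 => // n /= Nn V Vn.
have oUn := open_cover_iterated n cf oU.
have [->|/set0P V0] := eqVneq V set0.
  by apply: subordinateS (subordinate_set1 x0 oUn.2).
have [d0|d0] := ltP 0 (diam [set: X]).
  apply: subordinate_lebesgue_number => //; apply: le_lt_trans Vn _.
  have L0 := lebesgue_number_gt0 cX oUn d0.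
  have := HN n (ltnW Nn); rewrite !lte_fin => nh.
  have n0 : (0 < n%:R :> R)%R by rewrite ltr0n (leq_trans _ Nn).
  rewrite -[ltRHS]lnK ?posrE// ltr_expR ltrNl mulrC -ltr_pdivrMr//.
  by rewrite mulNr mulrC.
(* With diameter 0 the Lebesgue number is 0 and gives no information, but then V is a single
   point. *)
have [x Vx] := V0; apply: subordinateS (subordinate_set1 x oUn.2) => y Vy.
apply: mdist_positivity; apply/eqP; rewrite eq_le mdist_ge0 andbT -lee_fin.
exact: le_trans (@mdist_le_diam setT y x I I) d0.
Qed.

End metric.

(** * Bowen diameters against metric diameters *)

Section bowen.
Context {R : realType} {T : Type} (f : T -> T) (U : set (set T)).
Implicit Types V : set T.

Lemma bowen_diam_le (n : nat) V : subordinate V (iterated_cover f U n) ->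
  bowen_diam f U V <= (expR (- n%:R) : R)%:E.
Proof.
move=> VU; rewrite -[leRHS]/(expeR (- n%:R%:E)) lee_expeR leeN2.
apply: ereal_sup_ubound; exists n => // k.
exact: subordinate_iterated_cover.
Qed.

(* If n is the largest integer with r <= exp(- n h), then exp(- (n + 1) h) < r,
   while bowen_diam V <= exp(- n). *)
Lemma bowen_diam_powR_le {h l r : R} {N : nat} {V} :
  (0 < h)%R -> (0 < l)%R -> (0 <= r)%R ->
  (forall n, (N <= n)%N -> (r <= expR (- (n%:R * h)))%R ->
    subordinate V (iterated_cover f U n)) ->
  (r <= expR (- (N%:R * h)))%R ->
  poweR (bowen_diam f U V) (l * h) <= (expR (l * h) * r `^ l)%:E.
Proof.
move=> h0 l0 r0 sub rN.
have lh0 : (0 < l * h)%R by rewrite mulr_gt0.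
have bd n : (N <= n)%N -> (r <= expR (- (n%:R * h)))%R ->
    bowen_diam f U V <= (expR (- n%:R) : R)%:E.
  by move=> Nn rn; apply/bowen_diam_le/sub.
have := expeR_ge0 (- bowen_time f U V : \bar R)%E.
rewrite -/(bowen_diam f U V); move: bd.
case: (bowen_diam f U V) => [b| |] // bd; last first.
  by have := bd N (leqnn N) rN; rewrite leye_eq.
rewrite lee_fin poweR_EFin lee_fin => b0.
(* For r = 0 no largest n exists: the bound exp(- n) holds for every n >= N, which forces b = 0. *)
have [rE|rN0] := eqVneq r 0%R.
  subst r; suff -> : b = 0%R by rewrite !powR0 ?gt_eqF// mulr0.
  apply/eqP; rewrite eq_le b0 andbT leNgt; apply/negP => bp.
  pose n := (N + (Num.truncn (- ln b)).+1)%N.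
  have := bd n (leq_addr _ _) (expR_ge0 _); rewrite lee_fin leNgt => /negP; apply.
  rewrite -[ltRHS]lnK ?posrE// ltr_expR ltrNl.
  by apply: lt_le_trans (truncnS_gt _) _; rewrite ler_nat leq_addl.
have rp : (0 < r)%R by rewrite lt_neqAle eq_sym rN0.
(* The real solution of r = exp(- x h); its integer part is the largest admissible n. *)
pose x := (- ln r / h)%R.
have Nx : (N%:R <= x)%R.
  by rewrite ler_pdivlMr// lerNr -[leRHS]expRK ler_ln ?posrE ?expR_gt0.
have x0 : (0 <= x)%R by apply: le_trans Nx.
have /andP[nx xn] := truncn_itv x0; set n := Num.truncn x in nx xn.
have rn : (r <= expR (- (n%:R * h)))%R.
  by rewrite -[leLHS]lnK ?posrE// ler_expR lerNr -ler_pdivlMr.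
have := bd n _ rn; rewrite lee_fin truncn_ge_nat// => /(_ Nx) bn.
apply: (@le_trans _ _ (expR (- n%:R) `^ (l * h))%R).
  by apply: ge0_ler_powR; rewrite ?nnegrE ?expR_ge0// ltW.
rewrite -expRM /powR (gt_eqF rp) -expRD ler_expR.
move: xn; rewrite /x ltr_pdivrMr// -natr1 => xn.
have : (l * - ln r <= l * ((n%:R + 1) * h))%R by rewrite ler_pM2l// ltW.
lra.
Qed.

End bowen.

(** * Hausdorff-type measures and their critical exponents *)

Section outer_size.
Context {R : realType} {T : Type}.
Implicit Types w : set T -> \bar R.

(** Shrinking e leaves fewer covers and raises the infimum, so the limit at 0 is a supremum. *)
Lemma hausdorff_type_measureE w (l : R) :
  hausdorff_type_measure w l =
  ereal_sup [set premeasure w l e | e in [set e | (0 < e)%R]].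
Proof.
apply/cvg_lim => //.
have := @nonincreasing_at_right_cvge R (premeasure w l) 0%R (BInfty R false) isT.
rewrite (_ : [set` _] = [set e | (0 < e)%R]); last first.
  by apply/seteqP; split => x /=; rewrite in_itv /= andbT.
apply=> e e' _ _ ee'; apply: ereal_inf_le_tmp => _ [B [cB iB sB] <-].
by exists B => //; split=> //; apply: (lt_le_trans sB); rewrite lee_fin.
Qed.

Lemma epow_ge0 (x : \bar R) (l : R) : 0 <= epow x l.
Proof. by rewrite /epow; case: ifP => // _; exact: poweR_ge0. Qed.

Lemma premeasure_ge0 w (l e : R) : 0 <= premeasure w l e.
Proof.
by apply: le_ereal_inf_tmp => _ [B _ <-]; apply: esum_ge0 => *; exact: epow_ge0.
Qed.

Lemma hausdorff_type_measure_ge0 w (l : R) : 0 <= hausdorff_type_measure w l.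
Proof.
rewrite hausdorff_type_measureE; apply: le_trans (premeasure_ge0 w l 1%R) _.
by apply: ereal_sup_ubound; exists 1%R => /=.
Qed.

Lemma premeasure_le_hausdorff_type_measure w (l e : R) : (0 < e)%R ->
  premeasure w l e <= hausdorff_type_measure w l.
Proof.
by move=> e0; rewrite hausdorff_type_measureE; apply: ereal_sup_ubound; exists e.
Qed.

(** Comparison principle: a cover that is fine for [w] is itself fine for [w'], and its sum grows by
    a factor of at most C. *)
Lemma hausdorff_type_measure_eq0 w w' (l l' C : R) : (0 <= C)%R ->
  (forall e', (0 < e')%R -> exists2 e, (0 < e)%R & forall V, w V < e%:E ->
    w' V <= e'%:E /\ epow (w' V) l' <= C%:E * epow (w V) l) ->
  hausdorff_type_measure w l = 0 -> hausdorff_type_measure w' l' = 0.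
Proof.
move=> C0 H mu0; apply/eqP; rewrite eq_le hausdorff_type_measure_ge0 andbT.
rewrite hausdorff_type_measureE; apply: ge_ereal_sup => _ [e' /= e'0 <-].
(* Halving e' turns the weak bound on each member into the strict bound on the supremum. *)
have [|e e0 He] := H (e' / 2)%R; first by rewrite divr_gt0.
apply/lee_addgt0Pr => d d0; rewrite add0e.
(* Dividing d by C + 1 rather than C allows C = 0. *)
have C1 : (0 < C + 1)%R by lra.
have : premeasure w l e < (d / (C + 1))%:E.
  apply: le_lt_trans (premeasure_le_hausdorff_type_measure w l e e0) _.
  by rewrite mu0 lte_fin divr_gt0.
move=> /ereal_inf_lt[_ [B [cB iB sB] <-] Bd].
have HB V : B V ->
    w' V <= (e' / 2)%:E /\ epow (w' V) l' <= C%:E * epow (w V) l.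
  by move=> BV; apply: He; apply: le_lt_trans sB; apply: ereal_sup_ubound; exists V.
apply: (@le_trans _ _ (cover_sum w' B l')).
  apply: ereal_inf_lbound; exists B => //; split=> //.
  apply: (@le_lt_trans _ _ (e' / 2)%:E); last by rewrite lte_fin; lra.
  by apply: ge_ereal_sup => _ [V BV <-]; exact: (HB V BV).1.
apply: (@le_trans _ _ (C%:E * cover_sum w B l)).
  apply: ge_ereal_sup => _ [F [finF FB] <-].
  apply: (@le_trans _ _ (\sum_(V \in F) (C%:E * epow (w V) l))).
    by apply: lee_fsum => // V FV; exact: (HB V (FB V FV)).2.
  rewrite -ge0_mule_fsumr; last by move=> V; exact: epow_ge0.
  apply: lee_wpmul2l; first by rewrite lee_fin.
  by apply: ereal_sup_ubound; exists F.
apply: (@le_trans _ _ (C%:E * (d / (C + 1))%:E)).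
  by apply: lee_wpmul2l; [rewrite lee_fin|exact: ltW].
rewrite -EFinM lee_fin mulrCA ger_pMr// ler_pdivrMr// mul1r; lra.
Qed.

(** At exponent 0 each member of a cover contributes 1, even one of size 0, and a cover of an
    inhabited space has a member. So the measure at exponent 0 is not 0. *)
Lemma critical_exponent_ge0 w (h : \bar R) (x : T) :
  is_critical_exponent (hausdorff_type_measure w) h -> 0 <= h.
Proof.
move=> [_ hgt]; rewrite leNgt; apply/negP => /hgt mu0.
have := premeasure_le_hausdorff_type_measure w 0%R 1%R ltr01.
rewrite mu0 leNgt => /negP; apply; apply: (@lt_le_trans _ _ 1) => //.
apply: le_ereal_inf_tmp => _ [B [_ cB _] <-].
have [V BV _] : (\bigcup_(A in B) A) x by rewrite cB.
apply: (@le_trans _ _ (epow (w V) 0)); first by rewrite /epow ltxx andbF poweRe0.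
rewrite -(@esum_set1 R _ V (fun V => epow (w V) 0%R)) ?epow_ge0//.
apply: ereal_sup_le => _ [F [finF FV] <-]; exists F => //; split=> //.
by move=> A /FV ->.
Qed.

(** The empty family covers an empty space with sum 0, so the measure vanishes at every real
    exponent, negative ones included. *)
Lemma critical_exponent_empty w (h : \bar R) : ~ inhabited T ->
  is_critical_exponent (hausdorff_type_measure w) h -> h = -oo.
Proof.
move=> T0 hw; apply: (is_critical_exponent_uniq hw); split=> [l|l _].
  by rewrite ltNge leNye.
apply/eqP; rewrite eq_le hausdorff_type_measure_ge0 andbT.
rewrite hausdorff_type_measureE; apply: ge_ereal_sup => _ [e /= e0 <-].
apply: ereal_inf_lbound; exists set0; last exact: esum_set0.
split=> //; first by apply/seteqP; split=> // x; exfalso; apply: T0.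
by rewrite /cover_size image_set0 ereal_sup0 ltNyr.
Qed.

End outer_size.

(** * Bounding the Bowen entropy *)

Lemma bowen_entropy_le {R : realType} {X : metricType R} {f : X -> X}
    {U : set (set X)} (x0 : X) (l h : R) :
  compact [set: X] -> continuous f -> open_cover U ->
  (0 < l)%R -> (0 < h)%R -> hausdorff_dimension X < l%:E ->
  lebesgue_entropy f U < h%:E -> bowen_entropy f U <= (l * h)%:E.
Proof.
move=> cX cf oU l0 h0 Dl Hh.
have lh0 : (0 < l * h)%R by rewrite mulr_gt0.
rewrite leNgt; apply/negP => /(bowen_entropyP (R := R) f U).1.
suff -> : bowen_measure f U (l * h)%R = 0 :> \bar R by [].
apply: (hausdorff_type_measure_eq0 (@diam R X) _ l _ (expR (l * h))).
- exact: expR_ge0.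
- move=> e' e'0.
  have [N _ HN] := lebesgue_entropy_subordinate x0 cX cf oU Hh.
  (* M >= N makes subordination available, and M > - ln e' gives exp(- M) < e'. *)
  pose M := (N + (Num.truncn (- ln e')).+1)%N.
  exists (expR (- (M%:R * h))); first exact: expR_gt0.
  move=> V VM; split.
    apply: (@le_trans _ _ (expR (- M%:R))%:E).
      by apply/bowen_diam_le/HN; [exact: leq_addr|exact: ltW].
    rewrite lee_fin -[leRHS]lnK ?posrE// ler_expR lerNl ltW//.
    by apply: lt_le_trans (truncnS_gt _) _; rewrite ler_nat leq_addl.
  rewrite /epow !(ltNge _ 0%R) (ltW l0) (ltW lh0) !andbF.
  have := diam_ge0 V; case dV : (diam V) VM => [r| |] // VM.
  rewrite lee_fin => r0; rewrite poweR_EFin -EFinM.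
  apply: (bowen_diam_powR_le f U (N := M)) => //; last by rewrite -lee_fin ltW.
  move=> n Mn rn; apply: HN; last by rewrite dV lee_fin.
  by apply: leq_trans Mn; exact: leq_addr.
- exact: (hausdorff_dimensionP X).2.
Qed.

Theorem theorem4p8 (R : realType) (X : metricType R) (f : X -> X)
    (U : set (set X)) :
  compact [set: X] -> continuous f -> finite_set U -> open_cover U ->
  (* the product is not of the indeterminate form 0 * oo *)
  hausdorff_dimension X *? lebesgue_entropy f U ->
  hausdorff_dimension X * lebesgue_entropy f U >= bowen_entropy f U.
Proof.
move=> cX cf _ oU.
have [[x0]|X0] := pselect (inhabited X); last first.
  by rewrite (critical_exponent_empty _ _ X0 (bowen_entropyP f U)) leNye.
have D0 := critical_exponent_ge0 _ _ x0 (hausdorff_dimensionP X).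
have H0 := lebesgue_entropy_ge0 f U cX.
have hle l h := @bowen_entropy_le R X f U x0 l h cX cf oU.
move: D0 H0 hle; case: (hausdorff_dimension X) => [D| |] //;
  case: (lebesgue_entropy f U) => [H| |] //.
- rewrite !lee_fin => D0 H0 hle _; rewrite -EFinM.
  apply/lee_addgt0Pr => e e0.
  (* Since t <= 1, (D + t)(H + t) <= D H + t (D + H + 1) <= D H + e. *)
  pose t := Num.min 1%R (e / (D + H + 1))%R.
  have DH1 : (0 < D + H + 1)%R by lra.
  have t0 : (0 < t)%R by rewrite lt_min ltr01 divr_gt0.
  have t1 : (t <= 1)%R by rewrite ge_min lexx.
  have te : (t * (D + H + 1) <= e)%R by rewrite -ler_pdivlMr// ge_min lexx orbT.
  apply: (@le_trans _ _ ((D + t) * (H + t))%:E).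
    by apply: hle; rewrite ?lte_fin; lra.
  by rewrite -EFinD lee_fin; nra.
(* With one factor infinite, definedness of the product makes the other nonzero, so the product is
   +oo. *)
- rewrite lee_fin /mule_def => D0 _ _ DN0.
  by rewrite gt0_muley ?leey// lte_fin lt0r DN0.
- rewrite lee_fin /mule_def => _ H0 _ HN0.
  by rewrite gt0_mulye ?leey// lte_fin lt0r HN0.
- by move=> *; rewrite mulyy leey.
Qed.
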